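(* Let $1\leq p\leq q\leq\infty$, and let $E$ be a (resp., $p$-barrelled) locally convex space. Then a bounded subset $A$ of $E$ is a $(p,q)$-limited (resp., $(p,q)$-$\mathcal{E}$-limited) set if and only if the adjoint map $T_A^\ast: E'_{w^\ast}\to \ell_\infty(A)$ of the operator $T_A:\ell_1^0(A)\to E$ is $(q,p)$-convergent.
   Context: All locally convex spaces (lcs) are Hausdorff, over $\mathbb{F}\in\{\mathbb{R},\mathbb{C}\}$; $\omega=\{0,1,2,\dots\}$; ''operator'' means continuous linear map. $E'$ is the topological dual of $E$ and $E'_{w^\ast}=(E',\sigma(E',E))$. For a non-empty bounded set $A\subseteq E$, $\ell_1^0(A)$ is the linear span of the canonical unit vectors $e_a$ ($a\in A$) in $\ell_1(A)$ with the $\ell_1$-norm, and $T_A:\ell_1^0(A)\to E$ is the (continuous) linear map $T_A(\lambda_0e_{a_0}+\dots+\lambda_ne_{a_n}):=\lambda_0a_0+\dots+\lambda_na_n$ ($n\in\omega$, $\lambda_i\in\mathbb{F}$, $a_i\in A$). Its adjoint is $T_A^\ast(\chi)=\chi\circ T_A\in(\ell_1^0(A))'=\ell_\infty(A)$, where $\ell_\infty(A)$ carries the sup-norm. For $\chi\in E'$, $\|\chi\|_A:=\sup\{|\chi(x)|:x\in A\cup\{0\}\}$. A sequence $\{x_n\}$ in an lcs $F$ is weakly $p$-summable if $(\langle\chi,x_n\rangle)_n\in\ell_p$ (or $\in c_0$ if $p=\infty$) for every $\chi\in F'$. A sequence in $E'$ is weak$^\ast$ $p$-summable if it is weakly $p$-summable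 in $E'_{w^\ast}$. A non-empty $A\subseteq E$ is $(p,q)$-limited (resp., $(p,q)$-$\mathcal{E}$-limited) if $(\|\chi_n\|_A)_n\in\ell_q$ if $q<\infty$, or $\|\chi_n\|_A\to0$ if $q=\infty$, for every (resp., every equicontinuous) weak$^\ast$ $p$-summable sequence $\{\chi_n\}$ in $E'$. $E$ is $p$-barrelled if every weak$^\ast$ $p$-summable sequence in $E'$ is equicontinuous. A linear map $T:F\to L$ between lcs is $(q,p)$-convergent if it sends weakly $p$-summable sequences in $F$ to strongly $q$-summable sequences in $L$, where $\{y_n\}$ in $L$ is strongly $q$-summable if $(\rho(y_n))_n\in\ell_q$ (or $\in c_0$ if $q=\infty$) for every continuous seminorm $\rho$ on $L$ (for normed $L$: $(\|y_n\|)_n\in\ell_q$, or $\in c_0$ if $q=\infty$). *)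

(* Defs.v *)
From HB Require Import structures.
From mathcomp Require Import all_boot all_order all_algebra finmap ring.
From mathcomp Require Import all_classical all_reals all_analysis.
From mathcomp Require Import complex.

Set Implicit Arguments.
Unset Strict Implicit.
Unset Printing Implicit Defensive.

Import Order.TTheory GRing.Theory Num.Theory.
Import numFieldNormedType.Exports.

Local Open Scope classical_set_scope.
Local Open Scope ring_scope.

Section operator.
Context (K : numFieldType) (E F : tvsType K).

Definition is_operator : {pred E -> F} :=
  [pred f : E -> F | `[< linear f /\ continuous f >]].

Record operator := Operator {
  operator_fun :> E -> F;
  operatorP : operator_fun \in is_operator }.

HB.instance Definition _ := [isSub for operator_fun].
HB.instance Definition _ := [Choice of operator by <:].

Lemma is_operator_submod : submod_closed is_operator.
Proof.
split.
  apply/asboolP; split; first by move=> a x y /=; rewrite scaler0 addr0.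
  by move=> x; exact: cvg_cst.
move=> a f g /asboolP[lf cf] /asboolP[lg cg]; apply/asboolP; split.
  move=> b x y; rewrite /= !fctE lf lg !scalerDr !scalerA (mulrC a b).
  by rewrite addrACA.
move=> x; apply: (@continuous_comp E (F * F)%type F
  (fun x => (a *: f x, g x)) (fun z => z.1 + z.2)); last exact: add_continuous.
apply: cvg_pair; last exact: cg.
apply: (@continuous_comp E (K^o * F)%type F
  (fun x => (a, f x)) (fun z => z.1 *: z.2)); last exact: scale_continuous.
by apply: (@cvg_pair _ _ _ _ (nbhs (a : K^o))); [exact: cvg_cst|exact: cf].
Qed.

HB.instance Definition _ :=
  GRing.isSubmodClosed.Build K (E -> F) is_operator is_operator_submod.
HB.instance Definition _ := [SubChoice_isSubLmodule of operator by <:].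

Lemma operator_linear (f : operator) : linear f.
Proof. by have /asboolP[] := operatorP f. Qed.

Lemma operator_continuous (f : operator) : continuous f.
Proof. by have /asboolP[] := operatorP f. Qed.

HB.instance Definition _ (f : operator) :=
  GRing.isLinear.Build K E F *:%R f (operator_linear f).

End operator.

Definition dual (K : numFieldType) (E : tvsType K) := operator E K^o.

(* E' with sigma(E', E), i.e. the topology induced by the product topology on
   the functions from E to K. *)
Definition weak_dual (K : numFieldType) (E : tvsType K) : Type := dual E.

Section weak_dual.
Context (K : numFieldType) (E : tvsType K).

Definition weak_dual_eval (chi : dual E) : {ptws E -> K^o} := chi.

HB.instance Definition _ := GRing.Lmodule.on (weak_dual E).
HB.instance Definition _ :=
  Uniform.copy (weak_dual E) (initial_topology weak_dual_eval).

Lemma eval_weak_dual_continuous (x : E) :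
  continuous (fun chi : weak_dual E => (chi : dual E) x : K^o).
Proof.
move=> chi; apply: (@continuous_comp (weak_dual E) {ptws E -> K^o} K^o
  weak_dual_eval (fun f => f x)).
  exact: (@initial_continuous (dual E) _ weak_dual_eval).
exact: (@proj_continuous {classic E} (fun=> K^o) x).
Qed.

Lemma cvg_weak_dual (G : set_system (weak_dual E)) (chi : weak_dual E) :
  Filter G ->
  (forall x : E, (fun psi : weak_dual E => (psi : dual E) x : K^o) @ G -->
    ((chi : dual E) x : K^o)) ->
  G --> chi.
Proof.
move=> FG Gchi U [? /= [[W oW <-]]] Wchi /filterS; apply.
suff : weak_dual_eval @ G --> (weak_dual_eval chi : {ptws E -> K^o}).
  by apply; exact: open_nbhs_nbhs.
apply/cvg_sup => x V [? /= [[Q oQ <-]]] Qchi /filterS; apply.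
by apply: (Gchi x); exact: open_nbhs_nbhs.
Qed.

Lemma weak_dual_add_continuous :
  continuous (fun z : weak_dual E * weak_dual E => z.1 + z.2).
Proof.
move=> z; apply: cvg_weak_dual => x.
suff : (fun z : weak_dual E * weak_dual E =>
    ((z.1 : dual E) x + (z.2 : dual E) x : K^o)) @ z -->
    ((z.1 : dual E) x + (z.2 : dual E) x : K^o) by [].
apply: cvgD.
  apply: (@continuous_comp _ _ _ fst
    (fun chi : weak_dual E => (chi : dual E) x : K^o)); first exact: cvg_fst.
  exact: eval_weak_dual_continuous.
apply: (@continuous_comp _ _ _ snd
  (fun chi : weak_dual E => (chi : dual E) x : K^o)); first exact: cvg_snd.
exact: eval_weak_dual_continuous.
Qed.

Lemma weak_dual_scale_continuous :
  continuous (fun z : K^o * weak_dual E => z.1 *: z.2).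
Proof.
move=> z; apply: cvg_weak_dual => x.
suff : (fun z : K^o * weak_dual E => (z.1 *: (z.2 : dual E) x : K^o)) @ z -->
    (z.1 *: (z.2 : dual E) x : K^o) by [].
apply: cvgZ; first exact: cvg_fst.
apply: (@continuous_comp _ _ _ snd
  (fun chi : weak_dual E => (chi : dual E) x : K^o)); first exact: cvg_snd.
exact: eval_weak_dual_continuous.
Qed.

Lemma weak_dual_locally_convex : exists2 B : set_system (weak_dual E),
  (forall b, b \in B -> convex_set b) & basis B.
Proof.
exists [set U | open U /\ convex_set U] => [b|]; first by rewrite inE => -[].
split; first by move=> b [].
move=> chi.
pose D := [set U : set (weak_dual E) | (open U /\ convex_set U) /\ U chi].
suff : filter_from D id --> chi.
  by move=> h U /h [V DV VU]; exists V.
have FD : Filter (filter_from D id).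
  apply: filter_from_filter.
    by exists setT; split => //; split; [exact: openT|move=> *; rewrite inE].
  move=> U V [[oU cU] Uc] [[oV cV] Vc]; exists (U `&` V) => //.
  split=> //; split; first exact: openI.
  move=> f g l; rewrite !in_setI => /andP[fU fV] /andP[gU gV].
  by rewrite cU ?cV.
apply: cvg_weak_dual => x; apply/cvgrPdist_lt => e e0.
exists [set psi : weak_dual E | ball ((chi : dual E) x : K^o) e ((psi : dual E) x)].
  split; last exact: ballxx.
  split.
    apply: (@open_comp _ _ (fun psi : weak_dual E => (psi : dual E) x : K^o)).
      by move=> ? _; exact: eval_weak_dual_continuous.
    exact: ball_open.
  apply/convex_setW => f g; rewrite !inE -!ball_normE /= => fe ge l l0 l1.
  rewrite inE/=; set c := (chi : dual E) x in fe ge *; set t : K := l%:num in l0 l1.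
  suff : `|c - (t * (f : dual E) x + (1 - t) * (g : dual E) x)| < e by [].
  rewrite [X in `|X|](_ : _ = t * (c - (f : dual E) x) +
      (1 - t) * (c - (g : dual E) x)); last first.
    by rewrite !mulrBr addrACA -opprD -mulrDl subrKC mul1r.
  have t1 : 0 < 1 - t by rewrite subr_gt0.
  rewrite (le_lt_trans (ler_normD _ _))// !normrM (gtr0_norm l0) (gtr0_norm t1).
  have -> : e = t * e + (1 - t) * e by rewrite -mulrDl subrKC mul1r.
  by rewrite ltrD// ltr_pM2l.
by move=> psi; rewrite /= -ball_normE.
Qed.

HB.instance Definition _ := PreTopologicalNmodule_isTopologicalNmodule.Build
  (weak_dual E) weak_dual_add_continuous.
HB.instance Definition _ := TopologicalNmodule_isTopologicalLmodule.Build
  K (weak_dual E) weak_dual_scale_continuous.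
HB.instance Definition _ :=
  Uniform_isTvs.Build K (weak_dual E) weak_dual_locally_convex.

End weak_dual.

Section l10.
Context (K : numFieldType) (I : choiceType).

(* l_1^0(I): the span of the canonical unit vectors, with the l_1 norm. Its
   elements are finitely supported, so the sum in l10_norm is finite. *)
Definition unit_vector (i : I) : I -> K^o := fun j => (j == i)%:R.

Definition in_l10 : {pred I -> K^o} :=
  [pred f : I -> K^o | `[< exists n (c : 'I_n -> K) (a : 'I_n -> I),
    f = \sum_(k < n) c k *: unit_vector (a k) >]].

Record l10 := L10 { l10_fun :> I -> K^o; l10P : l10_fun \in in_l10 }.

HB.instance Definition _ := [isSub for l10_fun].
HB.instance Definition _ := [Choice of l10 by <:].

Lemma in_l10_submod : submod_closed in_l10.
Proof.
split.
  have a : 'I_0 -> I by case.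
  apply/asboolP; exists 0%N, (fun=> 0), a.
  by rewrite big_ord0.
move=> b f g /asboolP[n [c [a ->]]] /asboolP[m [d [e ->]]]; apply/asboolP.
exists (n + m)%N,
  (fun k : 'I_(n + m) => match fintype.split k with inl i => b * c i | inr j => d j end),
  (fun k : 'I_(n + m) => match fintype.split k with inl i => a i | inr j => e j end).
rewrite big_split_ord /= scaler_sumr; congr (_ + _); apply: eq_bigr => i _.
  by rewrite (unsplitK (inl _ i)) scalerA.
by rewrite (unsplitK (inr _ i)).
Qed.

HB.instance Definition _ :=
  GRing.isSubmodClosed.Build K (I -> K^o) in_l10 in_l10_submod.
HB.instance Definition _ := [SubChoice_isSubLmodule of l10 by <:].

Lemma l10_support (f : l10) :
  exists S : {fset I}, forall i, i \notin S -> f i = 0.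
Proof.
have /asboolP[n [c [a ->]]] := l10P f.
exists [fset a k | k in 'I_n]%fset => i iS.
rewrite fct_sumE big1// => k _; rewrite !fctE /unit_vector.
case: eqP => [ia|]; last by rewrite scaler0.
by case/negP: iS; apply/imfsetP; exists k.
Qed.

Definition l10_norm (f : l10) : K := \sum_(i \in [set: I]) `|f i|.

Lemma l10_normE (f : l10) (S : {fset I}) :
  (forall i, i \notin S -> f i = 0) -> l10_norm f = \sum_(i <- S) `|f i|.
Proof. by move=> fS; apply: fsbigTE => i /fS ->; rewrite normr0. Qed.

Lemma l10_normD (f g : l10) : l10_norm (f + g) <= l10_norm f + l10_norm g.
Proof.
have [S fS] := l10_support f; have [T gT] := l10_support g.
have f0 i : i \notin (S `|` T)%fset -> f i = 0.
  by rewrite in_fsetU negb_or => /andP[/fS].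
have g0 i : i \notin (S `|` T)%fset -> g i = 0.
  by rewrite in_fsetU negb_or => /andP[_ /gT].
rewrite (l10_normE f0) (l10_normE g0) (@l10_normE _ (S `|` T)%fset).
  by rewrite -big_split /=; apply: ler_sum => i _; exact: ler_normD.
by move=> i iST; rewrite [LHS](_ : _ = f i + g i)// f0// g0// addr0.
Qed.

Lemma l10_normZ (c : K) (f : l10) : l10_norm (c *: f) = `|c| * l10_norm f.
Proof.
have [S fS] := l10_support f.
rewrite (l10_normE fS) (@l10_normE _ S).
  by rewrite mulr_sumr; apply: eq_bigr => i _; rewrite -normrM.
by move=> i /fS fi; rewrite [LHS](_ : _ = c * f i)// fi mulr0.
Qed.

Lemma l10_norm0_eq0 (f : l10) : l10_norm f = 0 -> f = 0.
Proof.
have [S fS] := l10_support f; rewrite (l10_normE fS) => f0.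
apply/val_inj/funext => i /=; rewrite [RHS](_ : _ = 0)//.
have [iS|/fS//] := boolP (i \in S).
move/eqP: f0; rewrite psumr_eq0// => /allP/(_ i iS)/=.
by rewrite normr_eq0 => /eqP.
Qed.

HB.instance Definition _ :=
  Lmodule_isNormed.Build K l10 l10_normD l10_normZ l10_norm0_eq0.

Lemma unit_vector_l10 (i : I) : unit_vector i \in in_l10.
Proof.
apply/asboolP; exists 1%N, (fun=> 1), (fun=> i).
by rewrite big_ord1 scale1r.
Qed.

Definition l10_unit (i : I) : l10 := L10 (unit_vector_l10 i).

Lemma norm_l10_unit (i : I) : `|l10_unit i| = 1.
Proof.
rewrite [LHS](_ : _ = l10_norm (l10_unit i))//.
rewrite (@l10_normE _ [fset i]%fset) ?big_seq_fset1 /= /unit_vector ?eqxx ?normr1//.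
by move=> j; rewrite in_fset1 => /negPf /= ->.
Qed.

End l10.

(* A is absorbed by every neighbourhood of 0. *)
Definition tvs_bounded (K : numFieldType) (E : tvsType K) (A : set E) :=
  forall U : set E, nbhs 0 U ->
    exists2 r : K, 0 < r & forall t : K, r <= `|t| -> A `<=` [set t *: u | u in U].

Section l10_map.
Context (K : numFieldType) (E : tvsType K) (A : set E).

(* T_A; l10_map_comb is the usual formula on linear combinations of unit
   vectors. *)
Definition l10_map (f : l10 K A) : E := \sum_(a \in [set: A]) f a *: set_val a.

Lemma l10_mapE (f : l10 K A) (S : {fset A}) :
  (forall a, a \notin S -> f a = 0) ->
  l10_map f = \sum_(a <- S) f a *: set_val a.
Proof. by move=> fS; apply: fsbigTE => a /fS ->; rewrite scale0r. Qed.

Lemma l10_map_linear : linear l10_map.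
Proof.
move=> c f g; have [S fS] := l10_support f; have [T gT] := l10_support g.
have f0 i : i \notin (S `|` T)%fset -> f i = 0.
  by rewrite in_fsetU negb_or => /andP[/fS].
have g0 i : i \notin (S `|` T)%fset -> g i = 0.
  by rewrite in_fsetU negb_or => /andP[_ /gT].
rewrite (l10_mapE f0) (l10_mapE g0) (@l10_mapE _ (S `|` T)%fset).
  rewrite scaler_sumr -big_split /=; apply: eq_bigr => i _.
  by rewrite scalerA -scalerDl.
by move=> i iST; rewrite [LHS](_ : _ = c * f i + g i)// f0// g0// mulr0 addr0.
Qed.

HB.instance Definition _ :=
  GRing.isLinear.Build K (l10 K A) E *:%R l10_map l10_map_linear.

Lemma l10_map_unit (a : A) : l10_map (l10_unit K a) = set_val a.
Proof.
rewrite (@l10_mapE _ [fset a]%fset).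
  by rewrite big_seq_fset1 /= /unit_vector eqxx scale1r.
by move=> b; rewrite in_fset1 /= /unit_vector => /negPf ->.
Qed.

Lemma l10_map_comb n (c : 'I_n -> K) (a : 'I_n -> A) :
  l10_map (\sum_(i < n) c i *: l10_unit K (a i)) =
  \sum_(i < n) c i *: set_val (a i).
Proof.
rewrite linear_sum; apply: eq_bigr => i _.
by rewrite linearZ /= l10_map_unit.
Qed.

Lemma convex_comb (B : set E) (s : seq A) (c : A -> K) (v : A -> E) :
  @convex_set K E B -> B 0 -> (forall a, 0 <= c a) -> (forall a, B (v a)) ->
  exists2 b, B b & \sum_(a <- s) c a *: v a = (\sum_(a <- s) c a) *: b.
Proof.
move=> cB B0 c0 vB; elim: s => [|a s [b Bb IH]].
  by exists 0 => //; rewrite !big_nil scaler0.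
rewrite !big_cons {}IH; set S := \sum_(_ <- _) _.
have S0 : 0 <= S by rewrite sumr_ge0.
have [aS0|aS] := eqVneq (c a + S) 0.
  move/eqP: aS0; rewrite paddr_eq0// => /andP[/eqP-> /eqP->].
  by exists 0; rewrite ?addr0 ?scale0r ?addr0.
have aS_gt0 : 0 < c a + S by rewrite lt_neqAle eq_sym aS addr_ge0.
have t0 : 0 <= c a / (c a + S) by rewrite divr_ge0// addr_ge0.
have t1 : c a / (c a + S) <= 1 by rewrite ler_pdivrMr// mul1r lerDl.
exists ((c a / (c a + S)) *: v a + (1 - c a / (c a + S)) *: b).
  have := cB (v a) b (Itv01 t0 t1); rewrite !inE => /(_ (vB a) Bb).
  by [].
rewrite scalerDr !scalerA mulrBr mulr1 mulrCA mulfV// mulr1.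
by rewrite (addrC (c a)) addrK.
Qed.

Lemma l10_map_continuous0 : tvs_bounded A -> {for 0, continuous l10_map}.
Proof.
move=> bA U; rewrite /= [l10_map 0]linear0 => U0.
have [BB cBB BBo] := @locally_convex K E.
have [B [BBB B0] BU] : exists2 B, BB B /\ B 0 & B `<=` U.
  by have [_ /(_ 0 U U0)] := BBo.
have cB : @convex_set K E B by apply: cBB; rewrite inE.
have nB : nbhs (0 : E) B.
  apply: open_nbhs_nbhs; split => //.
  by case: (BBo) => + _; apply.
have := @scale_continuous K E (0, 0) B.
rewrite /= scaler0 => /(_ nB)[[W1 W2] /= [W1n W2n] WB].
have [e /= e0 eW1] : exists2 e : K, 0 < e & forall x : K, `|x| < e -> W1 x.
  have /nbhs_ballP[e e0 eW] : nbhs (0 : K^o) W1 by [].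
  by exists e => // x xe; apply: eW; rewrite -ball_normE /= sub0r normrN.
have [r r0 rA] := bA _ W2n.
have vW2 (a : A) : W2 (r^-1 *: set_val a).
  have [u W2u <-] := rA r ltac:(by rewrite gtr0_norm) (set_val a) (set_valP a).
  by rewrite scalerA mulVf ?gt_eqF// scale1r.
pose d := e / 2.
have d0 : 0 < d by rewrite divr_gt0.
apply/nbhs_ballP; exists (d / r); first by rewrite /= divr_gt0.
move=> f; rewrite -ball_normE /= sub0r normrN => fd; apply: BU.
have [S fS] := l10_support f; rewrite (l10_mapE fS).
pose c a : K := `|f a| * (r / d).
pose w a := (d * (f a / `|f a|)) *: (r^-1 *: set_val a : E).
have c0 a : 0 <= c a by rewrite /c mulr_ge0// divr_ge0 ?ltW.
have wB a : B (w a).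
  apply: (WB (_, _)); split => //=; last exact: vW2.
  apply: eW1; rewrite normrM (gtr0_norm d0).
  rewrite (@le_lt_trans _ _ d)//; last first.
    by rewrite /d ltr_pdivrMr// mulr_natr mulr2n ltrDl.
  rewrite ler_piMr ?(ltW d0)// normrM normfV normr_id.
  have [->|fa0] := eqVneq (f a) 0; first by rewrite normr0 mul0r ler01.
  by rewrite mulfV// normr_eq0.
have [b Bb] := convex_comb S cB B0 c0 wB.
have -> : \sum_(a <- S) c a *: w a = \sum_(a <- S) f a *: set_val a.
  apply: eq_bigr => a _; rewrite /c /w !scalerA.
  have [->|fa0] := eqVneq (f a) 0; first by rewrite normr0 !mul0r.
  congr (_ *: _); field.
  by rewrite normr_eq0 fa0 !gt_eqF.
move=> ->; set t := \sum_(_ <- _) _.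
have t0 : 0 <= t by rewrite sumr_ge0.
have t1 : t <= 1.
  rewrite /t -mulr_suml -(l10_normE fS) -ler_pdivlMr ?divr_gt0// div1r invf_div.
  exact: ltW.
have := cB b 0 (Itv01 t0 t1); rewrite !inE => /(_ Bb B0).
suff -> : (t *: b : E) = t *: b + (1 - t) *: 0 by [].
by rewrite scaler0 addr0.
Qed.

Lemma l10_map_continuous : tvs_bounded A -> continuous l10_map.
Proof.
move=> bA f.
have -> : l10_map = (fun g => l10_map (g - f) + l10_map f).
  by apply/funext => g; rewrite linearB subrK.
apply: (@continuous_comp (l10 K A) (E * E)%type E
  (fun g => (l10_map (g - f), l10_map f)) (fun z => z.1 + z.2));
  last exact: add_continuous.
have cst : (fun=> l10_map f) @ nbhs f --> l10_map f by exact: cvg_cst.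
apply: cvg_pair (cst).
apply: (@continuous_comp _ _ _ (fun g : l10 K A => g - f) l10_map).
  exact: (cvgB cvg_id (cvg_cst _)).
by rewrite /= subrr; exact: l10_map_continuous0.
Qed.

Lemma l10_map_operator : tvs_bounded A -> l10_map \in @is_operator K (l10 K A) E.
Proof.
move=> bA; apply/asboolP; split; first exact: l10_map_linear.
exact: l10_map_continuous.
Qed.

Definition l10_operator (bA : tvs_bounded A) : operator (l10 K A) E :=
  Operator (l10_map_operator bA).

End l10_map.

Section adjoint.
Context (K : numFieldType) (E F : tvsType K) (T : operator E F).

Lemma comp_operator (chi : dual F) : chi \o T \in @is_operator K E K^o.
Proof.
apply/asboolP; split; first by move=> a x y; rewrite /= !linearP.
move=> x; apply: continuous_comp; first exact: operator_continuous.
exact: (@operator_continuous K F K^o).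
Qed.

Definition adjoint (chi : dual F) : dual E := Operator (comp_operator chi).

End adjoint.

Variant scalar_kind := real_scalars | complex_scalars.

Definition scalar_field (R : realType) (k : scalar_kind) : numFieldType :=
  match k with
  | real_scalars => R
  | complex_scalars => R[i]%C
  end.

Section scalar.
Context (R : realType) (k : scalar_kind).

(* Norms take their values in the scalar field in MathComp-Analysis: modulus is
   the real-valued absolute value and of_real the inclusion of R. *)
Definition modulus : scalar_field R k -> R :=
  match k return scalar_field R k -> R with
  | real_scalars => fun x : R => `|x|
  | complex_scalars => fun x : R[i]%C => complex.Re `|x|
  end.

Definition of_real : R -> scalar_field R k :=
  match k return R -> scalar_field R k with
  | real_scalars => id
  | complex_scalars => real_complex R
  end.

Lemma of_real_modulus (x : scalar_field R k) : of_real (modulus x) = `|x|.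
Proof.
by rewrite /of_real /modulus; case: k x.
Qed.

Lemma ler_of_real (x y : R) : (of_real x <= of_real y) = (x <= y).
Proof. by rewrite /of_real; case: k => //=; rewrite lecR. Qed.

Lemma of_realD (x y : R) : of_real (x + y) = of_real x + of_real y.
Proof. by rewrite /of_real; case: k => //=; rewrite rmorphD. Qed.

Lemma of_realM (x y : R) : of_real (x * y) = of_real x * of_real y.
Proof. by rewrite /of_real; case: k => //=; rewrite rmorphM. Qed.

Lemma of_real0 : of_real 0 = 0.
Proof. by rewrite /of_real; case: k. Qed.

Lemma of_real_inj : injective of_real.
Proof.
move=> x y xy; apply/eqP; rewrite eq_le -!ler_of_real.
by rewrite xy lexx.
Qed.

Lemma modulus_ge0 (x : scalar_field R k) : 0 <= modulus x.
Proof. by rewrite -ler_of_real of_real0 of_real_modulus. Qed.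

Lemma modulusD (x y : scalar_field R k) : modulus (x + y) <= modulus x + modulus y.
Proof. by rewrite -ler_of_real of_realD !of_real_modulus ler_normD. Qed.

Lemma modulusM (x y : scalar_field R k) : modulus (x * y) = modulus x * modulus y.
Proof. by apply: of_real_inj; rewrite of_realM !of_real_modulus normrM. Qed.

Lemma modulus0_eq0 (x : scalar_field R k) : modulus x = 0 -> x = 0.
Proof.
by move=> x0; apply/normr0_eq0; rewrite -of_real_modulus x0 of_real0.
Qed.

Lemma modulus0 : modulus 0 = 0.
Proof. by apply: of_real_inj; rewrite of_real_modulus normr0 of_real0. Qed.

End scalar.

Section linfty.
Context (R : realType) (k : scalar_kind) (I : Type).
Local Notation K := (scalar_field R k).

Definition in_linfty : {pred I -> K^o} :=
  [pred f : I -> K^o | `[< exists M : R, forall i, modulus (f i) <= M >]].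

Record linfty := Linfty {
  linfty_fun :> I -> K^o;
  linftyP : linfty_fun \in in_linfty }.

HB.instance Definition _ := [isSub for linfty_fun].
HB.instance Definition _ := [Choice of linfty by <:].

Lemma in_linfty_submod : submod_closed in_linfty.
Proof.
split; first by apply/asboolP; exists 0 => i; rewrite modulus0.
move=> c f g /asboolP[M fM] /asboolP[N gN]; apply/asboolP.
exists (modulus c * M + N) => i; apply: (le_trans (modulusD _ _)).
by rewrite [X in X + _]modulusM lerD// ler_wpM2l// modulus_ge0.
Qed.

HB.instance Definition _ :=
  GRing.isSubmodClosed.Build K (I -> K^o) in_linfty in_linfty_submod.
HB.instance Definition _ := [SubChoice_isSubLmodule of linfty by <:].

Definition sup_norm (f : linfty) : R := sup [set modulus (f i) | i in [set: I]].

Lemma modulus_sup_norm (f : linfty) (i : I) : modulus (f i) <= sup_norm f.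
Proof.
apply: sup_upper_bound; last by exists i.
have /asboolP[M fM] := linftyP f.
by split; [exists (modulus (f i)), i|exists M => _ [j _ <-]].
Qed.

Lemma sup_norm_ge0 (f : linfty) : 0 <= sup_norm f.
Proof.
have [[i _]|I0] := pselect ([set: I] !=set0).
  exact: le_trans (modulus_ge0 _) (modulus_sup_norm f i).
rewrite /sup_norm; have -> : [set: I] = set0.
  by apply/eqP/negPn/negP => /set0P.
by rewrite image_set0 sup0.
Qed.

Lemma sup_norm_le (f : linfty) (M : R) :
  0 <= M -> (forall i, modulus (f i) <= M) -> sup_norm f <= M.
Proof.
move=> M0 fM; have [[i _]|I0] := pselect ([set: I] !=set0).
  by apply: ge_sup => [|_ [j _ <-]//]; exists (modulus (f i)), i.
rewrite /sup_norm; have -> : [set: I] = set0.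
  by apply/eqP/negPn/negP => /set0P.
by rewrite image_set0 sup0.
Qed.

Definition linfty_norm (f : linfty) : K := of_real k (sup_norm f).

Lemma linfty_normD (f g : linfty) :
  linfty_norm (f + g) <= linfty_norm f + linfty_norm g.
Proof.
rewrite /linfty_norm -of_realD ler_of_real; apply: sup_norm_le => [|i].
  by rewrite addr_ge0 ?sup_norm_ge0.
by apply: (le_trans (modulusD _ _)); rewrite lerD ?modulus_sup_norm.
Qed.

Lemma linfty_normZ (c : K) (f : linfty) :
  linfty_norm (c *: f) = `|c| * linfty_norm f.
Proof.
rewrite /linfty_norm -of_real_modulus -of_realM; congr of_real.
have le_scale (d : K) (g : linfty) : sup_norm (d *: g) <= modulus d * sup_norm g.
  apply: sup_norm_le => [|i]; first by rewrite mulr_ge0 ?sup_norm_ge0 ?modulus_ge0.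
  by rewrite [leLHS]modulusM ler_wpM2l ?modulus_ge0 ?modulus_sup_norm.
apply/eqP; rewrite eq_le le_scale /=.
have [->|c0] := eqVneq c 0; first by rewrite modulus0 mul0r sup_norm_ge0.
have c1 : modulus c * modulus c^-1 = 1.
  rewrite -modulusM mulfV//; apply: (@of_real_inj _ k).
  by rewrite of_real_modulus normr1; case: (k).
rewrite -[leRHS]mul1r -c1 -mulrA ler_wpM2l ?modulus_ge0//.
by rewrite (le_trans _ (le_scale _ _))// scalerA mulVf// scale1r.
Qed.

Lemma linfty_norm0_eq0 (f : linfty) : linfty_norm f = 0 -> f = 0.
Proof.
rewrite /linfty_norm -(of_real0 R k) => /of_real_inj f0.
apply/val_inj/funext => i; apply: modulus0_eq0; apply/eqP.
by rewrite eq_le modulus_ge0 -f0 modulus_sup_norm.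
Qed.

HB.instance Definition _ :=
  Lmodule_isNormed.Build K linfty linfty_normD linfty_normZ linfty_norm0_eq0.

End linfty.

Section dual_l10.
Context (R : realType) (k : scalar_kind) (I : choiceType).
Local Notation K := (scalar_field R k).

Lemma dual_l10_bounded (phi : dual (l10 K I)) :
  (fun i => phi (l10_unit K i)) \in @in_linfty R k I.
Proof.
have /linear_boundedP/pinfty_ex_gt0[r r0 phir] :
    bounded_near (phi : {linear l10 K I -> K^o}) (nbhs (0 : l10 K I)).
  exact/continuous_linear_bounded/operator_continuous.
apply/asboolP; exists (modulus r) => i.
rewrite -(ler_of_real k) !of_real_modulus (gtr0_norm r0).
by rewrite (le_trans (phir _))// norm_l10_unit mulr1.
Qed.

(* The identification of the dual of l_1^0(I) with l_oo(I). *)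
Definition dual_l10 (phi : dual (l10 K I)) : linfty R k I :=
  Linfty (dual_l10_bounded phi).

End dual_l10.

Section adjoint_l10_map.
Context (R : realType) (k : scalar_kind).
Local Notation K := (scalar_field R k).
Context (E : tvsType K) (A : set E) (bA : tvs_bounded A).

Definition adjoint_l10_map (chi : weak_dual E) : linfty R k A :=
  dual_l10 (adjoint (l10_operator bA) chi).

Lemma adjoint_l10_map_linear : linear adjoint_l10_map.
Proof. by move=> c f g; apply/val_inj/funext => i. Qed.

HB.instance Definition _ :=
  GRing.isLinear.Build K (weak_dual E) (linfty R k A) *:%R adjoint_l10_map
    adjoint_l10_map_linear.

End adjoint_l10_map.

(* u \in l_p for 1 <= p < +oo, u \in c_0 for p = +oo. *)
Definition in_lp (R : realType) (p : \bar R) (u : R^nat) : Prop :=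
  match p with
  | r%:E => cvgn (series (fun n => `|u n| `^ r))
  | +oo%E => u n @[n --> \oo] --> 0
  | -oo%E => False
  end.

Section summability.
Context (R : realType) (k : scalar_kind).
Local Notation K := (scalar_field R k).

Definition weakly_summable (p : \bar R) (F : tvsType K) (x : nat -> F) :=
  forall chi : dual F, in_lp p (fun n => modulus (chi (x n))).

Definition is_seminorm (L : tvsType K) (rho : L -> R) :=
  (forall x y, rho (x + y) <= rho x + rho y) /\
  (forall (c : K) x, rho (c *: x) = modulus c * rho x).

Definition strongly_summable (q : \bar R) (L : tvsType K) (y : nat -> L) :=
  forall rho : L -> R, is_seminorm rho -> continuous rho ->
    in_lp q (fun n => rho (y n)).

(* (q, p)-convergent maps. *)
Definition convergent (q p : \bar R) (F L : tvsType K) (T : {linear F -> L}) :=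
  forall x : nat -> F, weakly_summable p x -> strongly_summable q (T \o x).

Context (E : tvsType K).

Definition weak_star_summable (p : \bar R) (chi : nat -> dual E) :=
  @weakly_summable p (weak_dual E) chi.

(* ||chi||_A, possibly infinite when A is not bounded. *)
Definition sup_on (A : set E) (chi : dual E) : \bar R :=
  ereal_sup [set (modulus (chi x))%:E | x in A `|` [set 0]].

Definition sup_on_in_lp (q : \bar R) (A : set E) (chi : nat -> dual E) :=
  (forall n, sup_on A (chi n) \is a fin_num) /\
  in_lp q (fun n => fine (sup_on A (chi n))).

Definition equicontinuous_seq (chi : nat -> dual E) :=
  equicontinuous [set: nat] (fun n => chi n : E -> K^o).

Definition limited (p q : \bar R) (A : set E) :=
  forall chi : nat -> dual E, weak_star_summable p chi -> sup_on_in_lp q A chi.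

Definition E_limited (p q : \bar R) (A : set E) :=
  forall chi : nat -> dual E, equicontinuous_seq chi ->
    weak_star_summable p chi -> sup_on_in_lp q A chi.

Definition p_barrelled (p : \bar R) :=
  forall chi : nat -> dual E, weak_star_summable p chi -> equicontinuous_seq chi.

End summability.

(* Main.v *)
Require Import Defs.
From mathcomp Require Import all_boot all_order all_algebra.
From mathcomp Require Import all_classical all_reals all_analysis.

Set Implicit Arguments.
Unset Strict Implicit.
Unset Printing Implicit Defensive.

Import Order.TTheory GRing.Theory Num.Theory.
Import numFieldNormedType.Exports.

(** The statement rests on one identity and one reduction.

    The identity: for every [chi] in the dual of [E], the supremum of
    [|chi|] over [A] together with [0] is the sup-norm of [T_A^* chi].
    Indeed [T_A] maps the unit vector [e_a] to [a], so that the coordinate of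
    [T_A^* chi] at [a] is [chi a], while the point [0] adds only the value
    [chi 0 = 0] to a set of nonnegative numbers ([sup_onE]).

    The reduction: strong summability quantifies over all continuous seminorms,
    but in a normed space each of them is dominated by a multiple of the norm,
    and the norm is itself a continuous seminorm.  As [l_q] and [c_0] are stable
    under scaling and domination, a sequence is strongly [q]-summable if and
    only if the sequence of its norms lies in [l_q], or in [c_0]
    ([strongly_summable_normed]).

    Together they say that [(||chi_n||_A)_n] lies in [l_q] exactly when
    [(T_A^* chi_n)_n] is strongly [q]-summable ([sup_on_in_lpE]).  Quantifying
    over the weak-star [p]-summable sequences gives the first equivalence; on a
    [p]-barrelled space all these sequences are equicontinuous, so the second
    one is the same statement. *)

Local Open Scope classical_set_scope.
Local Open Scope ring_scope.

Lemma in_lp_le (R : realType) (q : \bar R) (C : R) (u v : R^nat) :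
  (0 <= q)%E -> 0 <= C -> (forall n, `|u n| <= C * `|v n|) ->
  in_lp q v -> in_lp q u.
Proof.
case: q => [r| |//]; rewrite ?lee_fin => q0 C0 uv /= hv.
  apply: (@series_le_cvg _ _ (C `^ r *: (fun n => `|v n| `^ r))).
  - by move=> n; exact: powR_ge0.
  - by move=> n; rewrite mulr_ge0 ?powR_ge0.
  - move=> n; rewrite [leRHS](_ : _ = C `^ r * `|v n| `^ r)// -powRM//.
    by apply: ge0_ler_powR => //; rewrite nnegrE ?mulr_ge0.
  - exact: is_cvg_seriesZ.
apply/norm_cvg0P; apply: (@squeeze_cvgr _ _ _ _ (cst 0) (fun n => C * `|v n|)).
- by apply: nearW => n; rewrite uv normr_ge0.
- exact: cvg_cst.
- by rewrite -[X in _ --> X](mulr0 C); apply: cvgMl_tmp; exact/norm_cvg0P.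
Qed.

Section seminorms.
Context (R : realType) (k : scalar_kind).
Local Notation K := (scalar_field R k).

Lemma of_realK (r : R) : 0 <= r -> modulus (of_real k r) = r.
Proof.
move=> r0; apply: (@of_real_inj _ k); rewrite of_real_modulus ger0_norm//.
by rewrite -(of_real0 R k) ler_of_real.
Qed.

Lemma ltr_of_real (x y : R) : (of_real k x < of_real k y) = (x < y).
Proof. by rewrite !lt_def ler_of_real (inj_eq (@of_real_inj _ k)). Qed.

Lemma modulusN1 : modulus (-1 : K) = 1.
Proof.
by apply: (@of_real_inj _ k); rewrite of_real_modulus normrN1; case: k.
Qed.

Lemma seminorm0 (L : tvsType K) (rho : L -> R) : is_seminorm rho -> rho 0 = 0.
Proof. by move=> [_ rhoZ]; rewrite -(scale0r 0) rhoZ modulus0 mul0r. Qed.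

(** Homogeneity for the scalar [-1] makes [rho] even, and then
    [0 = rho (x - x) <= 2 * rho x]. *)
Lemma seminorm_ge0 (L : tvsType K) (rho : L -> R) (x : L) :
  is_seminorm rho -> 0 <= rho x.
Proof.
move=> srho; have [rhoD rhoZ] := srho.
have := rhoD x (- x); rewrite subrr (seminorm0 srho) -scaleN1r rhoZ.
by rewrite modulusN1 mul1r -mulr2n pmulrn_lge0.
Qed.

Context (L : normedModType K).

(** The norm of [L] takes its values in the scalar field, whereas seminorms and
    the sequences tested for membership in [l_q] are real-valued. *)
Definition real_norm (x : L) : R := modulus `|x|.

Lemma of_real_norm (x : L) : of_real k (real_norm x) = `|x|.
Proof. by rewrite of_real_modulus normr_id. Qed.

Lemma real_norm_ge0 (x : L) : 0 <= real_norm x.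
Proof. exact: modulus_ge0. Qed.

Lemma real_norm_seminorm : @is_seminorm R k L real_norm.
Proof.
split=> [x y|c x].
  by rewrite -(ler_of_real k) of_realD !of_real_norm ler_normD.
by apply: (@of_real_inj _ k); rewrite of_realM !of_real_norm normrZ of_real_modulus.
Qed.

Lemma real_norm_continuous : continuous (real_norm : L -> R).
Proof.
move=> x; apply/cvgrPdist_lt => e e0.
have K0 : (0 : K) < of_real k e by rewrite -(of_real0 R k) ltr_of_real.
apply/nbhs_ballP; exists (of_real k e) => // y; rewrite -ball_normE /=.
rewrite -of_real_norm ltr_of_real; apply: le_lt_trans.
have [rhoD rhoZ] := real_norm_seminorm.
have norm_sub (u v : L) : real_norm u - real_norm v <= real_norm (u - v).
  by rewrite lerBlDr -{1}(subrK v u) rhoD.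
rewrite ler_norml norm_sub andbT lerNl opprB.
have -> : real_norm (x - y) = real_norm (y - x).
  by rewrite -(opprB y x) -scaleN1r rhoZ modulusN1 mul1r.
exact: norm_sub.
Qed.

(** Continuity at [0] gives a ball around [0] on which [rho < 1]; homogeneity
    spreads this local bound to the whole space. *)
Lemma continuous_seminorm_bounded (rho : L -> R) :
  is_seminorm rho -> continuous rho ->
  exists2 C, 0 <= C & forall x, rho x <= C * real_norm x.
Proof.
move=> srho crho; have [rhoD rhoZ] := srho.
have /cvgrPdist_lt/(_ 1 ltr01) := crho 0.
move=> /nbhs_ballP[e /= e0 eball].
have rho1 x : `|x| < e -> rho x < 1.
  move=> xe; have := eball x; rewrite -ball_normE /= sub0r normrN => /(_ xe).
  by rewrite (seminorm0 srho) sub0r normrN ger0_norm// seminorm_ge0.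
(* Half the radius, since the ball is open. *)
pose d := modulus e / 2.
have ed : e = of_real k (modulus e) by rewrite of_real_modulus gtr0_norm.
have me0 : 0 < modulus e by rewrite -ltr_of_real -ed of_real0.
have d0 : 0 < d by rewrite divr_gt0.
exists d^-1; first by rewrite invr_ge0 ltW.
move=> x; have [x0|x0] := eqVneq (real_norm x) 0.
  suff -> : x = 0 by rewrite (seminorm0 srho) mulr_ge0 ?real_norm_ge0 ?invr_ge0 ?ltW.
  by apply/normr0_eq0; rewrite -of_real_norm x0 of_real0.
have xgt0 : 0 < real_norm x by rewrite lt_def x0 real_norm_ge0.
(* Rescaled to norm [d], the vector lies in the ball where [rho < 1]. *)
pose c := d / real_norm x.
have c0 : 0 < c by rewrite divr_gt0.
have : rho (of_real k c *: x) < 1.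
  apply: rho1; rewrite -of_real_norm ed ltr_of_real (proj2 real_norm_seminorm).
  by rewrite (of_realK (ltW c0)) divfK// ltr_pdivrMr// mulr_natr mulr2n ltrDl.
rewrite rhoZ (of_realK (ltW c0)) => /ltW.
by rewrite mulrC -ler_pdivlMr// div1r invf_div mulrC.
Qed.

Lemma strongly_summable_normed (q : \bar R) (y : nat -> L) : (0 <= q)%E ->
  strongly_summable q y <-> in_lp q (fun n => real_norm (y n)).
Proof.
move=> q0; split=> [|yq rho srho crho].
  by apply; [exact: real_norm_seminorm|exact: real_norm_continuous].
have [C C0 rhoC] := continuous_seminorm_bounded srho crho.
apply: (in_lp_le q0 C0 _ yq) => n.
by rewrite !ger0_norm ?real_norm_ge0// seminorm_ge0.
Qed.

End seminorms.

Section adjoint.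
Context (R : realType) (k : scalar_kind).
Local Notation K := (scalar_field R k).

Lemma real_norm_linfty (I : Type) (f : linfty R k I) :
  real_norm f = sup_norm f.
Proof. by apply: (@of_real_inj _ k); rewrite of_real_norm. Qed.

Context (E : tvsType K) (A : set E) (bA : tvs_bounded A).

Lemma adjoint_l10_mapE (chi : weak_dual E) (a : A) :
  adjoint_l10_map bA chi a = (chi : dual E) (set_val a).
Proof. by rewrite -(@l10_map_unit K E A a). Qed.

(** The values of [|chi|] on [A] are the moduli of the coordinates of
    [T_A^* chi].  The point [0] of [A `|` [set 0]] keeps the supremum in
    [\bar R] nonnegative, where the sup-norm is [0] by convention on an empty
    index set. *)
Lemma sup_onE (chi : dual E) :
  sup_on A chi = (sup_norm (adjoint_l10_map bA chi))%:E.
Proof.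
apply/eqP; rewrite eq_le; apply/andP; split.
  apply: ge_ereal_sup => _ [x [Ax|->] <-]; rewrite lee_fin.
    have -> : x = set_val (SigSub (mem_set Ax) : A) by [].
    by rewrite -adjoint_l10_mapE modulus_sup_norm.
  by rewrite linear0 modulus0 sup_norm_ge0.
have ub x : (A `|` [set 0]) x -> ((modulus (chi x))%:E <= sup_on A chi)%E.
  by move=> Ax; apply: ereal_sup_ubound; exists x.
have s0 : (0 <= sup_on A chi)%E.
  by have := ub 0 (or_intror erefl); rewrite linear0 modulus0.
case: (sup_on A chi) ub s0 => [s| |//] ub s0; last by rewrite leey.
rewrite lee_fin; apply: sup_norm_le; first by rewrite -lee_fin.
by move=> a; rewrite -lee_fin adjoint_l10_mapE; apply: ub; left; exact: set_valP.
Qed.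

Lemma sup_on_in_lpE (q : \bar R) (chi : nat -> dual E) : (0 <= q)%E ->
  sup_on_in_lp q A chi <->
  @strongly_summable R k q (linfty R k A) (adjoint_l10_map bA \o chi).
Proof.
move=> q0; rewrite (strongly_summable_normed _ q0).
have -> : (fun n => real_norm ((adjoint_l10_map bA \o chi) n)) =
    (fun n => fine (sup_on A (chi n))).
  by apply/funext => n; rewrite sup_onE real_norm_linfty.
by split=> [[]//|hq]; split=> // n; rewrite sup_onE.
Qed.

Lemma limited_convergent (p q : \bar R) : (0 <= q)%E ->
  limited p q A <-> convergent q p (adjoint_l10_map bA).
Proof.
by move=> q0; split=> h chi /h /(sup_on_in_lpE _ q0).
Qed.

Lemma p_barrelled_E_limited (p q : \bar R) : p_barrelled E p ->
  E_limited p q A <-> limited p q A.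
Proof.
move=> bE; split=> [h chi chip|h chi _]; last exact: h.
by apply: h => //; exact: bE.
Qed.

End adjoint.

Theorem theorem3p4 (R : realType) (k : scalar_kind)
    (E : tvsType (scalar_field R k)) (hausdorffE : hausdorff_space E)
    (p q : \bar R) (p1 : (1 <= p)%E) (pq : (p <= q)%E)
    (A : set E) (A0 : A !=set0) (bA : tvs_bounded A) :
  (limited p q A <-> convergent q p (adjoint_l10_map bA)) /\
  (p_barrelled E p -> (E_limited p q A <-> convergent q p (adjoint_l10_map bA))).
Proof.
have q0 : (0 <= q)%E by rewrite (le_trans _ pq)// (le_trans _ p1)// lee_fin.
have lc := @limited_convergent R k E A bA p q q0; split=> // bE.
exact: iff_trans (@p_barrelled_E_limited R k E A p q bE) lc.
Qed.
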